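(* Let $n\ge3$ and $i\in\{0,1,2\}$, and suppose that there exist $r,m\in\mathbb{Z}$ such that $\alpha_i^m$ and $\alpha_i^r$ are conjugate in $B_n(\mathbb{S}^2)$. (a) If $i=1$ then $\alpha_1^m=\alpha_1^r$. (b) If $i\in\{0,2\}$ then $\alpha_i^m=\alpha_i^{r}$ or $\alpha_i^m=\alpha_i^{-r}$.
   Context: $B_n(\mathbb{S}^2)$ is the $n$-string braid group of the sphere, generated by $\sigma_1,\ldots,\sigma_{n-1}$ subject to $\sigma_i\sigma_j=\sigma_j\sigma_i$ if $|i-j|\ge 2$, $\sigma_i\sigma_{i+1}\sigma_i=\sigma_{i+1}\sigma_i\sigma_{i+1}$ for $1\le i\le n-2$, and $\sigma_1\cdots\sigma_{n-2}\sigma_{n-1}^2\sigma_{n-2}\cdots\sigma_1=1$. Set $\alpha_0=\sigma_1\cdots\sigma_{n-1}$ (of order $2n$), $\alpha_1=\sigma_1\cdots\sigma_{n-2}\sigma_{n-1}^2$ (of order $2(n-1)$), and $\alpha_2=\sigma_1\cdots\sigma_{n-3}\sigma_{n-2}^2$ (of order $2(n-2)$). *)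

(* Defs.v *)
(* boolp is used only to quotient words by a Prop-valued congruence. *)
From HB Require Import structures.
From mathcomp Require Import all_boot all_order all_algebra.
From mathcomp Require Import generic_quotient.
From mathcomp Require Import boolp.

Set Implicit Arguments.
Unset Strict Implicit.
Unset Printing Implicit Defensive.

Local Open Scope group_scope.
Local Open Scope quotient_scope.

(* A letter (x, true) stands for the generator x, (x, false) for its inverse. *)
Definition word (X : Type) : Type := seq (X * bool).

Definition invw (X : Type) (w : word X) : word X :=
  rev [seq (l.1, ~~ l.2) | l <- w].

(* The congruence on words generated by the relations R together with free
   cancellation; its quotient is the group presented by < X | R >. *)
Inductive wcong (X : Type) (R : word X -> word X -> Prop) :
    word X -> word X -> Prop :=
| wcong_rel u v : R u v -> wcong R u v
| wcong_cancel x b : wcong R [:: (x, b); (x, ~~ b)] [::]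
| wcong_cat u1 v1 u2 v2 :
    wcong R u1 v1 -> wcong R u2 v2 -> wcong R (u1 ++ u2) (v1 ++ v2)
| wcong_refl u : wcong R u u
| wcong_sym u v : wcong R u v -> wcong R v u
| wcong_trans u v w : wcong R u v -> wcong R v w -> wcong R u w.

Section PresentedGroup.
Variables (X : choiceType) (R : word X -> word X -> Prop).

Definition wcongb : rel (seq (X * bool)) := fun u v => `[< wcong R u v >].

Lemma wcongb_refl : reflexive wcongb.
Proof. by move=> u; apply/asboolP; apply: wcong_refl. Qed.

Lemma wcongb_sym : symmetric wcongb.
Proof. by move=> u v; apply/asboolP/asboolP; apply: wcong_sym. Qed.

Lemma wcongb_trans : transitive wcongb.
Proof.
by move=> v u w /asboolP uv /asboolP vw; apply/asboolP/(wcong_trans uv vw).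
Qed.

Canonical wcong_equiv := EquivRel wcongb wcongb_refl wcongb_sym wcongb_trans.

Definition presented : Type := {eq_quot wcong_equiv}.

HB.instance Definition _ := Choice.copy presented {eq_quot wcong_equiv}.

Definition pclass (w : word X) : presented := \pi_{eq_quot wcong_equiv} w.
Definition prepr (g : presented) : word X :=
  repr (g : {eq_quot wcong_equiv}).

Lemma preprK : cancel prepr pclass.
Proof. exact: reprK. Qed.

Lemma pclassP u v : pclass u = pclass v <-> wcong R u v.
Proof. by split=> [/eqmodP/asboolP // | uv]; apply/eqmodP/asboolP. Qed.

Definition pmul (g h : presented) : presented := pclass (prepr g ++ prepr h).
Definition pone : presented := pclass [::].
Definition pinv (g : presented) : presented := pclass (invw (prepr g)).

Lemma wcong_catVw w : wcong R (invw w ++ w) [::].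
Proof.
elim: w => [|[x b] w IHw]; first exact: wcong_refl.
rewrite /invw /= rev_cons -cats1 -catA.
apply: wcong_trans IHw; apply: wcong_cat; first exact: wcong_refl.
have := wcong_cancel R x (~~ b); rewrite negbK => xVx.
exact: wcong_cat xVx (wcong_refl R w).
Qed.

Lemma invwK : involutive (@invw X).
Proof.
move=> w; rewrite /invw map_rev revK -map_comp -[RHS]map_id.
by apply: eq_map => -[x b] /=; rewrite negbK.
Qed.

Lemma wcong_catwV w : wcong R (w ++ invw w) [::].
Proof. by have := wcong_catVw (invw w); rewrite invwK. Qed.

Lemma wcong_repr w : wcong R (prepr (pclass w)) w.
Proof. by apply/pclassP; rewrite preprK. Qed.

Lemma pmulA : associative pmul.
Proof.
move=> g h k; apply/pclassP.
apply: (wcong_trans (wcong_cat (wcong_refl R _) (wcong_repr _))).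
rewrite catA.
exact: wcong_cat (wcong_sym (wcong_repr _)) (wcong_refl R _).
Qed.

Lemma pmul1g : left_id pone pmul.
Proof.
move=> g; rewrite -[RHS]preprK; apply/pclassP.
exact: wcong_cat (wcong_repr [::]) (wcong_refl R _).
Qed.

Lemma pmulg1 : right_id pone pmul.
Proof.
move=> g; rewrite -[RHS]preprK; apply/pclassP.
rewrite -[X in wcong _ _ X]cats0.
exact: wcong_cat (wcong_refl R _) (wcong_repr [::]).
Qed.

Lemma pmulVg : left_inverse pone pinv pmul.
Proof.
move=> g; apply/pclassP; apply: wcong_trans (wcong_catVw (prepr g)).
exact: wcong_cat (wcong_repr _) (wcong_refl R _).
Qed.

Lemma pmulgV : right_inverse pone pinv pmul.
Proof.
move=> g; apply/pclassP; apply: wcong_trans (wcong_catwV (prepr g)).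
exact: wcong_cat (wcong_refl R _) (wcong_repr _).
Qed.

HB.instance Definition _ :=
  isGroup.Build presented pmulA pmul1g pmulg1 pmulVg pmulgV.

Lemma pclassM u v : pclass (u ++ v) = pclass u * pclass v.
Proof.
apply/pclassP; apply: wcong_sym.
exact: wcong_cat (wcong_repr _) (wcong_repr _).
Qed.

End PresentedGroup.

(* Indices of the generators sigma_1, ..., sigma_(n-1). *)
Definition braid_gen (n : nat) : choiceType := {k : nat | 0 < k < n}.

(* The one-letter word sigma_k; the empty word when k is not in [1, n-1]. *)
Definition sigmaw (n k : nat) : word (braid_gen n) :=
  if insub k is Some i then [:: (i, true)] else [::].

Inductive sphere_braid_rel (n : nat) :
    word (braid_gen n) -> word (braid_gen n) -> Prop :=
| far_comm i j : 0 < i < n -> 0 < j < n -> (i + 2 <= j) || (j + 2 <= i) ->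
    sphere_braid_rel (sigmaw n i ++ sigmaw n j) (sigmaw n j ++ sigmaw n i)
| braid i : 1 <= i <= n - 2 ->
    sphere_braid_rel (sigmaw n i ++ sigmaw n i.+1 ++ sigmaw n i)
                     (sigmaw n i.+1 ++ sigmaw n i ++ sigmaw n i.+1)
| sphere :
    sphere_braid_rel
      (\big[cat/[::]]_(1 <= k < n - 1) sigmaw n k
        ++ (sigmaw n (n - 1) ++ sigmaw n (n - 1))
        ++ \big[cat/[::]]_(k <- rev (index_iota 1 (n - 1))) sigmaw n k)
      [::].

Definition sphere_braid (n : nat) : groupType :=
  presented (@sphere_braid_rel n).

Definition sigma (n k : nat) : sphere_braid n :=
  pclass (@sphere_braid_rel n) (sigmaw n k).

Definition alpha0 (n : nat) : sphere_braid n :=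
  \prod_(1 <= k < n) sigma n k.

Definition alpha1 (n : nat) : sphere_braid n :=
  \prod_(1 <= k < n - 1) sigma n k * sigma n (n - 1) ^+ 2.

Definition alpha2 (n : nat) : sphere_braid n :=
  \prod_(1 <= k < n - 2) sigma n k * sigma n (n - 2) ^+ 2.

Definition alpha (n : nat) (i : 'I_3) : sphere_braid n :=
  match val i with 0 => alpha0 n | 1 => alpha1 n | _ => alpha2 n end.

Definition expgz (G : groupType) (x : G) (m : int) : G :=
  match m with Posz k => x ^+ k | Negz k => x ^- k.+1 end.

Definition conjugate (G : groupType) (x y : G) : Prop := exists g : G, y = x ^ g.

(* Main.v *)
Require Import Defs.
From mathcomp Require Import all_boot all_order all_algebra.
From mathcomp Require Import all_field.
From mathcomp Require Import zify ring.

(**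
Put k = n - i.  The power alpha_i ^+ k is the full twist for each i; it is
central (full_twist_central, alpha_full_twist).  The sphere relation says that
alpha_0 is inverse to its reversal, and the two are already conjugate by far
commutations alone (asc_desc_conj), so the full twist equals its inverse and
alpha_i ^+ (2 * k) = 1.  A power divisible by k is therefore fixed by every
conjugation.  For exponents m and r not divisible by k, conjugate powers have
to be separated modulo 2 * k, up to sign when i is 0 or 2.

For i = 1, 2 the element alpha_i rotates the first k strands by one k-th of a
full turn about the next strand, and exactly i strands keep their places.
Colour the strands, giving these i strands colours of their own, and let every
crossing add a weight that depends on the two colours.  This is an action of
the sphere braid group as soon as a strand carried around all the others
collects weight zero (balanced).  Since k does not divide m, a colouring fixed
by the m-th power of the twist must have its special colours on the last i
strands, and comparing collected weights across the conjugating element gives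
a congruence between m and r (twist_conj).  With one special colour it reads
m = r (twist1_conj).  With two special colours the weight is a winding number
around the axis through the two marked strands; the conjugating element may
exchange them, which accounts for the sign (twist2_conj).

For i = 0 no strand is distinguished, and the invariant is the trace of a
linear representation: the Burau representation at a primitive n-th root of
unity t.  A crossing exchanges two neighbouring entries and turns one of them
by the factor t about the other.  On rows for which the product of all n
rotations is trivial (closed_row), taken modulo constant rows, the sphere word
acts by a scalar, which a rescaling of the generators removes (row_sphere),
while alpha_0 becomes a rescaled cyclic shift of the n entries
(burau_moves_shift).  Hence the trace of the m-th power is
- (w ^+ m + w ^- m), where w is a primitive root of unity of order 2 * n with
t = w ^- 2 (trace_quot_rep_alpha0); it determines m modulo 2 * n up to sign.
*)

Set Implicit Arguments.
Unset Strict Implicit.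
Unset Printing Implicit Defensive.

(** * Coxeter words under the Artin relations *)

Section ArtinRelations.

Local Open Scope group_scope.

Variables (G : groupType) (x : nat -> G) (m : nat).

Hypothesis x_far : forall i j, 0 < i -> i.+1 < j -> j <= m -> commute (x i) (x j).
Hypothesis x_braid : forall i, 0 < i < m ->
  x i * (x i.+1 * x i) = x i.+1 * (x i * x i.+1).

Definition asc j := \prod_(1 <= k < j.+1) x k.
Definition desc j := \prod_(k <- rev (index_iota j.+1 m.+1)) x k.

Let asc0 : asc 0 = 1.
Proof. by rewrite /asc big_geq. Qed.

Let ascS j : asc j.+1 = asc j * x j.+1.
Proof. by rewrite /asc big_nat_recr. Qed.

Let descS j : j < m -> desc j = desc j.+1 * x j.+1.
Proof.
by move=> lt_jm; rewrite /desc /index_iota !subSS -(subnSK lt_jm) rev_cons big_rcons.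
Qed.

Let desc_max : desc m = 1.
Proof. by rewrite /desc /index_iota subnn big_nil. Qed.

Let asc_far j l : j.+1 < l -> l <= m -> commute (asc j) (x l).
Proof.
move=> lt_jl le_lm; apply/commute_sym; rewrite /asc big_nat_cond.
by apply: commute_prod => k /andP[/andP[k0 lekj] _]; apply/commute_sym/x_far; lia.
Qed.

Let asc_shift_le j i : 0 < i < j -> j <= m -> asc j * x i = x i.+1 * asc j.
Proof.
case: i => // i; elim: j => // j IHj /andP[_ lt_ij] lt_jm.
have [eq_ij|ne_ij] := eqVneq j i.+1.
  rewrite eq_ij in lt_jm *; rewrite !ascS -!mulgA x_braid ?lt_jm //.
  by rewrite !mulgA; congr (_ * _ * _); apply: asc_far.
rewrite ascS -mulgA -x_far //; last by lia.
by rewrite mulgA IHj ?mulgA //; lia.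
Qed.

Lemma asc_shift i : 0 < i < m -> asc m * x i = x i.+1 * asc m.
Proof. by move/asc_shift_le; apply. Qed.

Let expg_asc_shift j : j < m -> asc m ^+ j * x 1 = x j.+1 * asc m ^+ j.
Proof.
elim: j => [|j IHj] lt_jm; first by rewrite mul1g mulg1.
by rewrite expgS -mulgA IHj ?(ltnW lt_jm) // mulgA asc_shift ?mulgA.
Qed.

(** Conjugation by asc m raises indices by one; the square carries the last
    generator back to the first, which closes the cycle. *)
Lemma asc2_wrap : 0 < m -> asc m * (asc m * x m) = x 1 * (asc m * asc m).
Proof.
move=> m_gt0.
have slide j : j < m -> x 1 * (asc m * asc j) = asc j.+1 * asc m.
  elim: j => [|j IHj] lt_jm; first by rewrite ascS asc0 mulg1 mul1g.
  rewrite ascS 2!mulgA -[x 1 * _ * _]mulgA IHj ?(ltnW lt_jm) //.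
  by rewrite -mulgA asc_shift // [in RHS]ascS mulgA.
have aE : asc m = asc m.-1 * x m by rewrite -{1 3}(prednK m_gt0) ascS.
by rewrite {4}aE [in RHS]mulgA [in RHS]mulgA -[x 1 * _ * _]mulgA slide prednK // -mulgA.
Qed.

Lemma asc_expg_commute i : 0 < i <= m -> commute (asc m ^+ m.+1) (x i).
Proof.
case: i => // i /andP[_ lt_im].
have m_gt0 : 0 < m by apply: leq_ltn_trans lt_im.
have c1 : commute (asc m ^+ m.+1) (x 1).
  have aE : asc m ^+ m.+1 = asc m * asc m * asc m ^+ m.-1.
    by rewrite -expg2 -expgnDr add2n prednK.
  rewrite /commute aE -mulgA expg_asc_shift ?prednK //.
  by rewrite mulgA -(mulgA _ _ (x m)) asc2_wrap // !mulgA.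
rewrite -[x i.+1](mulgK (asc m ^+ i)) -expg_asc_shift //.
have cX : commute (asc m ^+ m.+1) (asc m ^+ i) by apply/commuteX2.
by apply: commuteM; [apply: commuteM | apply: commuteV].
Qed.

(** By asc2_wrap, asc m * x m is conjugate to x 1 * asc m, and in the powers of
    the latter the factors x 1 slide to the left as x 1, x 2, ..., x m. *)
Lemma asc_last_expg : 0 < m -> (asc m * x m) ^+ m = asc m ^+ m.+1.
Proof.
move=> m_gt0.
have slide j : j <= m -> (x 1 * asc m) ^+ j = asc j * asc m ^+ j.
  elim: j => [|j IHj] lt_jm; first by rewrite asc0 mulg1.
  rewrite expgSr IHj ?(ltnW lt_jm) // -mulgA [asc m ^+ j * _]mulgA.
  by rewrite expg_asc_shift // ascS -!mulgA -expgSr.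
have -> : asc m * x m = (x 1 * asc m) ^ asc m.
  by apply: (mulgI (asc m)); rewrite asc2_wrap // conjgE mulVKg mulgA.
by rewrite -conjXg slide // -expgS; apply/conjg_fixP/commgP/commute_sym/commuteX.
Qed.

(** The generators are reversed one at a time: in asc j.+1 * desc j.+1 the prefix
    asc j.+1 is rotated to the right end, and its part asc j commutes with
    desc j.+1. *)
Lemma asc_desc_conj : exists g, desc 0 = asc m ^ g.
Proof.
suff /(_ m (leqnn m))[g]: forall j, j <= m -> exists g, desc 0 = (asc j * desc j) ^ g.
  by rewrite desc_max mulg1; exists g.
elim=> [|j IHj] lt_jm; first by exists 1; rewrite asc0 mul1g conjg1.
have [g ->] := IHj (ltnW lt_jm); exists (asc j.+1 * g).
rewrite conjgM; congr (_ ^ g).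
rewrite conjgE -!mulgA mulKg ascS descS // !mulgA; congr (_ * _).
rewrite /commute /desc big_seq_cond; apply: commute_prod => k.
by rewrite mem_rev mem_index_iota andbT => ?; apply: asc_far; lia.
Qed.

(** The full twist on m strands splits off from the m-th power of the Coxeter
    word on m + 1 strands. *)
Lemma asc_pred_expg : 0 < m -> asc m ^+ m = asc m.-1 ^+ m * desc 0.
Proof.
move=> m_gt0.
have pass j : forall l, l.+1 + j = m -> desc l.+1 * asc m = asc m.-1 * desc l.
  elim: j => [|j IHj] l lj.
    rewrite addn0 in lj; rewrite (descS (j := l)) -?lj //= lj desc_max !mul1g.
    by rewrite -lj ascS.
  rewrite (descS (j := l.+1)); last by lia.
  rewrite -mulgA -asc_shift; last by lia.
  rewrite mulgA IHj; last by lia.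
  by rewrite -mulgA -descS; last by lia.
suff: forall j, j <= m -> asc m ^+ j = asc m.-1 ^+ j * desc (m - j).
  by move/(_ m (leqnn m)); rewrite subnn.
elim=> [|j IHj] lt_jm; first by rewrite subn0 desc_max mulg1.
rewrite expgSr IHj ?(ltnW lt_jm) // -(subnSK lt_jm) -mulgA (pass j) ?mulgA -?expgSr //.
by rewrite (subnSK lt_jm) subnK // ltnW.
Qed.

End ArtinRelations.

(** * The full twist of the sphere braid group *)

Section SphereBraidGroup.

Local Open Scope group_scope.

Variable n : nat.
Implicit Types (g h : sphere_braid n) (r : seq nat).

Lemma pclass_sigma_prod r :
  pclass (@sphere_braid_rel n) (\big[cat/[::]]_(k <- r) sigmaw n k)
  = \prod_(k <- r) sigma n k.
Proof. by elim/big_rec2: _ => //= k _ w _ <-; rewrite pclassM. Qed.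

Lemma sigma_far i j : 0 < i -> i.+1 < j -> j <= n.-1 ->
  commute (sigma n i) (sigma n j).
Proof.
move=> *; rewrite /commute /sigma -!pclassM.
by apply/pclassP/wcong_rel/far_comm; lia.
Qed.

Lemma sigma_braid i : 0 < i < n.-1 ->
  sigma n i * (sigma n i.+1 * sigma n i)
  = sigma n i.+1 * (sigma n i * sigma n i.+1).
Proof.
move=> *; rewrite /sigma -!(pclassM _ (sigmaw n _) (sigmaw n _)).
rewrite -!(pclassM _ (sigmaw n _)).
by apply/pclassP/wcong_rel/braid; lia.
Qed.

Lemma sphere_wordE (I : Type) (F : nat -> seq I) : 1 < n ->
  \big[cat/[::]]_(1 <= k < n - 1) F k ++ (F (n - 1) ++ F (n - 1))
    ++ \big[cat/[::]]_(k <- rev (index_iota 1 (n - 1))) F k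
  = \big[cat/[::]]_(k <- index_iota 1 n ++ rev (index_iota 1 n)) F k.
Proof.
case: n => [|[|p]] // _; rewrite subn1 big_cat /=.
have -> : index_iota 1 p.+2 = rcons (index_iota 1 p.+1) p.+1.
  by rewrite /index_iota !subSS !subn0 -[X in iota 1 X = _]addn1 iotaD cats1 add1n.
by rewrite rev_rcons big_cons -cats1 big_cat big_seq1 /= -!catA.
Qed.

Lemma sphere_relation : 1 < n ->
  asc (sigma n) n.-1 * desc (sigma n) n.-1 0 = 1.
Proof.
move=> n_gt1; rewrite /asc /desc prednK ?(ltnW n_gt1) //.
rewrite -!pclass_sigma_prod -pclassM -big_cat -sphere_wordE //.
exact/pclassP/wcong_rel/sphere.
Qed.

Lemma sigma_letter (k : braid_gen n) : sigmaw n (val k) = [:: (k, true)].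
Proof. by rewrite /sigmaw valK. Qed.

Lemma sigma_letterV (k : braid_gen n) :
  pclass (@sphere_braid_rel n) [:: (k, false)] = (sigma n (val k))^-1.
Proof.
apply/esym/mulg1_eq; rewrite /sigma sigma_letter -pclassM.
exact/pclassP/(wcong_cancel _ k true).
Qed.

Lemma sigma_central z : (forall k, 0 < k < n -> commute z (sigma n k)) ->
  forall g, commute z g.
Proof.
move=> cz g; rewrite -[g]preprK; elim: (prepr g) => [|[k b] w IHw].
  exact: commute1.
rewrite -cat1s pclassM; apply: commuteM => //; case: b.
  by rewrite -sigma_letter; apply/cz/(valP k).
by rewrite sigma_letterV; apply/commuteV/cz/(valP k).
Qed.

Hypothesis n_ge3 : 2 < n.

Let pn : n.-1.+1 = n. Proof. by rewrite prednK // ltnW // ltnW. Qed.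
Let a := asc (sigma n) n.-1.

Lemma full_twist_central g : commute (a ^+ n) g.
Proof.
apply: sigma_central => k k_lt; have <- : a ^+ n.-1.+1 = a ^+ n by rewrite pn.
by apply: asc_expg_commute; [apply: sigma_far | apply: sigma_braid | lia].
Qed.

(** The inverse of a is desc 0, a conjugate of a; both have the same n-th power
    because that of a is central. *)
Lemma full_twist2 : a ^+ n * a ^+ n = 1.
Proof.
have [g bE] := asc_desc_conj sigma_far.
have rE : a^-1 = desc (sigma n) n.-1 0 by apply/mulg1_eq/sphere_relation/ltnW.
have := congr1 (fun z => z ^+ n) bE; rewrite -rE -conjXg -/a expVgn.
by rewrite conjgE full_twist_central mulKg => {1}<-; rewrite mulVg.
Qed.

Lemma alpha_asc (i : 'I_3) :
  alpha n i = if val i is 0 then a else asc (sigma n) (n - i) * sigma n (n - i).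
Proof.
case: i => [[|[|[|//]]] i_lt]; rewrite /alpha /a /asc /=.
- by rewrite pn.
- rewrite /alpha1 expg2 mulgA; congr (_ * _).
  by rewrite big_nat_recr //= subn_gt0 ltnW.
- rewrite /alpha2 expg2 mulgA; congr (_ * _).
  by rewrite big_nat_recr //= subn_gt0.
Qed.

(** For i = 2 the twist lives on n - 1 strands, whose own full twist agrees with
    that of all n strands once the last strand is freed by the sphere relation. *)
Lemma alpha_full_twist (i : 'I_3) : alpha n i ^+ (n - i) = a ^+ n.
Proof.
rewrite alpha_asc; case: i => [[|[|[|//]]] i_lt] /=; first by rewrite subn0.
  rewrite subn1 asc_last_expg ?pn //; last by lia.
  - exact: sigma_far.
  - exact: sigma_braid.
have n2 : n - 2 <= n.-1 by lia.
rewrite asc_last_expg ?subn_gt0 //; first last.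
  - by move=> k k_lt; apply: sigma_braid; lia.
  - by move=> k l *; apply: sigma_far; lia.
have := asc_pred_expg sigma_far sigma_braid; rewrite -/a => /(_ ltac:(lia)).
have -> : n.-1.-1 = n - 2 by lia.
have -> : (n - 2).+1 = n.-1 by lia.
move=> /(congr1 (fun z => z * a)); rewrite -expgSr pn -mulgA => ->.
suff -> : desc (sigma n) n.-1 0 * a = 1 by rewrite mulg1.
have /mulg1_eq <- : a * desc (sigma n) n.-1 0 = 1 by apply/sphere_relation/ltnW.
by rewrite mulVg.
Qed.

End SphereBraidGroup.

(** * Actions of the sphere braid group *)

(** An action up to a partial equivalence relation.  Partiality restricts the
    domain to the x with same x x, and the relation itself passes to a quotient.  The sphere relation needs the first for coloured strands and both
    for the Burau representation, where the crossings stay linear maps of the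
    whole space. *)
Record sphere_action (n : nat) (T : Type) := SphereAction {
  cross : nat -> T -> T;
  uncross : nat -> T -> T;
  same : T -> T -> Prop;
  same_sym : forall x y, same x y -> same y x;
  same_trans : forall x y z, same x y -> same y z -> same x z;
  cross_same : forall k x y, 0 < k < n ->
    same x y -> same (cross k x) (cross k y);
  uncross_same : forall k x y, 0 < k < n ->
    same x y -> same (uncross k x) (uncross k y);
  crossK : forall k x, 0 < k < n -> same x x -> same (uncross k (cross k x)) x;
  uncrossK : forall k x, 0 < k < n ->
    same x x -> same (cross k (uncross k x)) x;
  cross_far : forall i j x, 0 < i -> i.+1 < j -> j < n -> same x x ->
    same (cross i (cross j x)) (cross j (cross i x));
  cross_braid : forall i x, 0 < i -> i.+1 < n -> same x x ->
    same (cross i (cross i.+1 (cross i x)))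
         (cross i.+1 (cross i (cross i.+1 x)));
  cross_sphere : forall x, same x x ->
    same (foldl (fun y k => cross k y) x
            (index_iota 1 n ++ rev (index_iota 1 n))) x
}.

Section ActionTheory.

Local Open Scope group_scope.

Variables (n : nat) (T : Type) (A : sphere_action n T).
Implicit Types (x y : T) (w : word (braid_gen n)) (g h : sphere_braid n).

Definition crosses x (r : seq nat) : T := foldl (fun y k => cross A k y) x r.

Definition run w x : T :=
  foldl (fun y l => if l.2 then cross A (val l.1) y
                    else uncross A (val l.1) y) x w.

(* Words are read from left to right, so this is a right action. *)
Definition act g x : T := run (prepr g) x.

Lemma run_cat u v x : run (u ++ v) x = run v (run u x).
Proof. exact: foldl_cat. Qed.

Lemma run_same w x y : same A x y -> same A (run w x) (run w y).
Proof.
elim: w x y => [|[k b] w IHw] x y xy //=; apply: IHw.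
have k_lt : 0 < val k < n := valP k.
by case: b => /=; [apply: cross_same | apply: uncross_same].
Qed.

Lemma run_sigmaw k x : 0 < k < n -> run (sigmaw n k) x = cross A k x.
Proof. by move=> k_lt; rewrite /sigmaw insubT. Qed.

Lemma run_sigmaw_prod r x : all (fun k => 0 < k < n) r ->
  run (\big[cat/[::]]_(k <- r) sigmaw n k) x = crosses x r.
Proof.
elim: r x => [|k r IHr] x /=; first by rewrite big_nil.
by case/andP=> k_lt r_lt; rewrite big_cons run_cat run_sigmaw // IHr.
Qed.

Lemma run_relation u v x : 1 < n ->
  sphere_braid_rel u v -> same A x x -> same A (run u x) (run v x).
Proof.
move=> n_gt1 uv xx; case: uv => [i j i_lt j_lt far|i i_lt|].
- rewrite !run_cat !run_sigmaw //; case/orP: far => far.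
    by apply/same_sym/cross_far => //; lia.
  by apply/cross_far => //; lia.
- have [i_gt0 lt_in] : 0 < i /\ i.+1 < n by lia.
  have i_n : 0 < i < n by rewrite i_gt0 ltnW.
  by rewrite !run_cat !run_sigmaw //; apply: cross_braid.
rewrite sphere_wordE // run_sigmaw_prod; first exact: cross_sphere.
rewrite all_cat all_rev andbb; apply/allP=> k.
by rewrite mem_index_iota.
Qed.

Hypothesis n_gt1 : 1 < n.

Lemma run_wcong u v : wcong (@sphere_braid_rel n) u v ->
  forall x, same A x x -> same A (run u x) (run v x).
Proof.
elim=> {u v} [u v uv|k b|u1 v1 u2 v2 _ IH1 _ IH2|u|u v _ IH|u v w _ IH1 _ IH2] x xx.
- exact: run_relation.
- have k_lt : 0 < val k < n := valP k.
  by case: b; [apply: crossK | apply: uncrossK].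
- rewrite !run_cat; apply: same_trans (IH2 _ (run_same v1 xx)).
  exact/run_same/IH1.
- exact: run_same.
- exact/same_sym/IH.
- exact: same_trans (IH1 _ xx) (IH2 _ xx).
Qed.

Lemma act_same g x y : same A x y -> same A (act g x) (act g y).
Proof. exact: run_same. Qed.

Lemma actM g h x : same A x x -> same A (act (g * h) x) (act h (act g x)).
Proof.
move=> xx; rewrite /act -run_cat; apply: run_wcong => //.
exact/pclassP/preprK.
Qed.

Lemma act1 x : same A x x -> same A (act 1 x) x.
Proof. by move=> xx; apply: (run_wcong (v := [::])) => //; apply/pclassP/preprK. Qed.

Lemma act_sigma_prod r x : all (fun k => 0 < k < n) r -> same A x x ->
  same A (act (\prod_(k <- r) sigma n k) x) (crosses x r).
Proof.
move=> r_lt xx; rewrite -run_sigmaw_prod //; apply: run_wcong => //.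
by apply/pclassP; rewrite preprK pclass_sigma_prod.
Qed.

End ActionTheory.

(** * Coloured strands *)

(** If a occurred once, a rotation by m modulo the size would have to keep its
    position, but that amount is not zero. *)
Lemma iter_rot1_fixed (Q : eqType) (f : seq Q) (m : nat) (a : Q) :
  iter m (rot 1) f = f -> ~~ (size f %| m) -> a \in f -> 1 < count_mem a f.
Proof.
move=> fixf ndvd a_f.
have f_gt0 : 0 < size f by case: f a_f {fixf ndvd}.
have iter_rot j : j <= size f -> iter j (rot 1) f = rot j f.
  elim: j => [|j IHj] lt_jf; first by rewrite rot0.
  by rewrite iterS IHj ?(ltnW lt_jf) // -rotS.
have full : iter (size f) (rot 1) f = f by rewrite iter_rot // rot_size.
set d := m %% size f; have d_lt : d < size f by rewrite ltn_pmod.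
have d_gt0 : 0 < d by rewrite lt0n.
have fixd : rot d f = f.
  rewrite -iter_rot ?(ltnW d_lt) // -[RHS]fixf [in RHS](divn_eq m (size f)) addnC iterD.
  congr iter; rewrite mulnC; elim: (m %/ _) => [|e IHe]; first by rewrite muln0.
  by rewrite mulnS addnC iterD full.
have := congr1 (index a) fixd; rewrite -[in RHS](cat_take_drop d f) /rot !index_cat.
have -> : count_mem a f = count_mem a (take d f) + count_mem a (drop d f).
  by rewrite -count_cat cat_take_drop.
move: a_f; rewrite -{1}(cat_take_drop d f) mem_cat.
rewrite size_takel ?(ltnW d_lt) // size_drop -!has_pred1 !has_count.
by case: ifP; case: ifP => /=; lia.
Qed.

Section ColouredStrands.

Local Open Scope ring_scope.

Import GRing.Theory.

Variables (Q : eqType) (V : zmodType) (w : Q -> Q -> V).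
Implicit Types (a b u : Q) (s p q f : seq Q) (z : V).

(* Positions count from 0 here, so sigma_k exchanges positions k - 1 and k. *)
Fixpoint swap_at k s : seq Q :=
  match k, s with
  | 0, a :: b :: s' => b :: a :: s'
  | k'.+1, a :: s' => a :: swap_at k' s'
  | _, _ => s
  end.

Fixpoint swap_weight k s : V :=
  match k, s with
  | 0, a :: b :: _ => w a b
  | k'.+1, _ :: s' => swap_weight k' s'
  | _, _ => 0
  end.

Lemma swapK k : involutive (swap_at k).
Proof.
elim: k => [|k IHk] [|a s] //=; last by rewrite IHk.
by case: s.
Qed.

Lemma perm_swap k s : perm_eq (swap_at k s) s.
Proof.
elim: k s => [|k IHk] [|a s] //=; last by rewrite perm_cons.
case: s => [|b s]; first exact: perm_refl.
exact/permEl/(perm_catCA [:: b] [:: a] s).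
Qed.

Lemma size_swap k s : size (swap_at k s) = size s.
Proof. exact/perm_size/perm_swap. Qed.

Lemma swap_far i j s : (i.+1 < j)%N ->
  [/\ swap_at i (swap_at j s) = swap_at j (swap_at i s),
      swap_weight i (swap_at j s) = swap_weight i s
    & swap_weight j (swap_at i s) = swap_weight j s].
Proof.
elim: i j s => [|i IHi] [|[|j]] [|a s] // lt_ij; first by case: s.
by have [//|eq_s eq_wi eq_wj] := IHi j.+1 s; split=> //=; congr (_ :: _).
Qed.

(** Both sides make every pair of the three strands cross exactly once, with the
    same strand on the left, so they collect the same three weights. *)
Lemma swap_braid i s : (i.+2 < size s)%N ->
  swap_at i (swap_at i.+1 (swap_at i s)) = swap_at i.+1 (swap_at i (swap_at i.+1 s)) /\
  swap_weight i s + swap_weight i.+1 (swap_at i s)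
    + swap_weight i (swap_at i.+1 (swap_at i s))
  = swap_weight i.+1 s + swap_weight i (swap_at i.+1 s)
    + swap_weight i.+1 (swap_at i (swap_at i.+1 s)).
Proof.
elim: i s => [|i IHi] [|a s] //= lt_is.
  case: s lt_is => [|b [|c s]] //= _; split=> //.
  by rewrite [RHS]addrC [w b c + _]addrC addrA.
by have [-> ->] := IHi s lt_is.
Qed.

Lemma swap_cat p a b s : swap_at (size p) (p ++ a :: b :: s) = p ++ b :: a :: s.
Proof. by elim: p => //= c p ->. Qed.

Lemma swap_weight_cat p a b s : swap_weight (size p) (p ++ a :: b :: s) = w a b.
Proof. by elim: p. Qed.

Definition colour_cross k (x : seq Q * V) : seq Q * V :=
  (swap_at k.-1 x.1, x.2 + swap_weight k.-1 x.1).

Definition colour_uncross k (x : seq Q * V) : seq Q * V :=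
  (swap_at k.-1 x.1, x.2 - swap_weight k.-1 (swap_at k.-1 x.1)).

Let colour_crosses := foldl (fun x k => colour_cross k x).

(* The suffix q allows slides that stop before the last strand. *)
Lemma slide_right p a s q z :
  colour_crosses (p ++ a :: s ++ q, z) (iota (size p).+1 (size s))
  = (p ++ s ++ a :: q, z + \sum_(b <- s) w a b).
Proof.
elim: s p z => [|b s IHs] p z /=; first by rewrite big_nil addr0.
rewrite /colour_cross /= swap_cat swap_weight_cat -cat_rcons.
by rewrite -(size_rcons p b) IHs cat_rcons big_cons addrA.
Qed.

Lemma slide_left p a s q z :
  colour_crosses (p ++ s ++ a :: q, z) (rev (iota (size p).+1 (size s)))
  = (p ++ a :: s ++ q, z + \sum_(b <- s) w b a).
Proof.
elim: s p z => [|b s IHs] p z /=; first by rewrite big_nil addr0.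
rewrite rev_cons /colour_crosses foldl_rcons -/colour_crosses -cat_rcons.
rewrite -(size_rcons p b) IHs cat_rcons size_rcons.
by rewrite /colour_cross /= swap_cat swap_weight_cat big_cons -addrA [w b a + _]addrC.
Qed.

Definition monodromy a b : V := w a b + w b a.

(** A strand that travels around all the others collects its monodromy with each
    of them; the term for the strand itself stands on both sides. *)
Definition balanced s : Prop :=
  forall a, a \in s -> \sum_(b <- s) monodromy a b = monodromy a a.

Lemma balanced_perm s1 s2 : perm_eq s1 s2 -> balanced s2 -> balanced s1.
Proof.
by move=> eq_s bal a; rewrite (perm_mem eq_s) (perm_big _ eq_s) => /bal.
Qed.

Variable n : nat.

Definition balanced_state s : Prop := size s = n /\ balanced s.

Definition same_state (x y : seq Q * V) : Prop := x = y /\ balanced_state x.1.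

Lemma balanced_swap k s : balanced_state s -> balanced_state (swap_at k s).
Proof.
case=> sz_s bal; split; first by rewrite size_swap.
exact: balanced_perm (perm_swap k s) bal.
Qed.

Lemma colour_cross_sphere x : same_state x x ->
  same_state (colour_crosses x (index_iota 1 n ++ rev (index_iota 1 n))) x.
Proof.
case: x => s z [_ sbal]; split; last first.
  elim: (_ ++ _) s z sbal => //= k r IHr s z sbal.
  exact/IHr/(balanced_swap _ sbal).
case: sbal => /= + bal; case: s bal => [|a s] bal <- //.
rewrite /index_iota subn1 /= /colour_crosses foldl_cat -/colour_crosses.
have := slide_right [::] a s [::] z; rewrite /= !cats0 => ->.
have /= -> := slide_left [::] a s [::] (z + \sum_(b <- s) w a b).
rewrite cats0 -addrA -big_split /=; congr (_, _).
have /eqP := bal a (mem_head _ _).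
by rewrite big_cons -subr_eq0 addrAC subrr add0r => /eqP ->; rewrite addr0.
Qed.

Definition colour_action : sphere_action n (seq Q * V).
Proof.
refine (@SphereAction n (seq Q * V) colour_cross colour_uncross same_state
  _ _ _ _ _ _ _ _ colour_cross_sphere).
- by move=> x y [-> vx].
- by move=> x y z [-> vx] [-> vy].
- by move=> k [s z] _ _ [<- vx]; split=> //; apply: balanced_swap vx.
- by move=> k [s z] _ _ [<- vx]; split=> //; apply: balanced_swap vx.
- move=> k [s z] _ [_ vx]; rewrite /colour_uncross /= swapK addrK.
  by split=> //; rewrite swapK; case: vx.
- move=> k [s z] _ [_ vx]; rewrite /colour_cross /= swapK subrK.
  by split=> //; rewrite swapK; case: vx.
- move=> i j [s z] i_gt0 lt_ij _ [_ vx].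
  have [|eq_s eq_wi eq_wj] := @swap_far i.-1 j.-1 s; first by lia.
  split; last exact/balanced_swap/balanced_swap/vx.
  by rewrite /colour_cross /= eq_s eq_wi eq_wj addrAC.
- move=> i [s z] i_gt0 lt_in [_ vx].
  have [|eq_s eq_w] := @swap_braid i.-1 s; first by case: vx => /= ->; lia.
  split; last exact/balanced_swap/balanced_swap/balanced_swap/vx.
  rewrite /colour_cross /=; rewrite prednK // in eq_s eq_w.
  by rewrite eq_s -!addrA; congr (_, z + _); rewrite !addrA.
Defined.

Lemma same_balanced x : balanced_state x.1 -> same colour_action x x.
Proof. by []. Qed.

Section TwistAction.

Hypothesis n_gt1 : (1 < n)%N.

Local Notation colour_act := (act colour_action).
Implicit Types (x : seq Q * V) (g h : sphere_braid n).

Lemma act_balanced g x : balanced_state x.1 -> balanced_state (colour_act g x).1.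
Proof.
by move=> vx; have [] := act_same (A := colour_action) g (same_balanced vx).
Qed.

Lemma colour_actM g h x : balanced_state x.1 ->
  colour_act (g * h)%g x = colour_act h (colour_act g x).
Proof. by move=> vx; have [] := actM n_gt1 g h (same_balanced vx). Qed.

Lemma colour_act1 x : balanced_state x.1 -> colour_act 1%g x = x.
Proof. by move=> vx; have [] := act1 n_gt1 (same_balanced vx). Qed.

Lemma act_perm g x : perm_eq (colour_act g x).1 x.1.
Proof.
rewrite /act; elim: (prepr g) x => //= [[k b] v IHv] x.
by apply: perm_trans (IHv _) _; case: b; apply: perm_swap.
Qed.

(** Crossings add to the label amounts that depend on the colours only. *)
Lemma act_translate g s z t :
  colour_act g (s, z + t) = ((colour_act g (s, z)).1, (colour_act g (s, z)).2 + t).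
Proof.
rewrite /act; elim: (prepr g) s z => //= [[k b] v IHv] s z.
by case: b; rewrite /= /colour_cross /colour_uncross /= addrAC IHv.
Qed.

(** The first strand passes the strands 2, ..., k and then goes once around strand
    k + 1, after which the first k strands are cyclically permuted; alpha_1 and
    alpha_2 are the cases k = n - 1 and k = n - 2. *)
Definition twist k : sphere_braid n := (asc (sigma n) k * sigma n k)%g.

Lemma act_twist a f u q z : balanced_state (a :: f ++ u :: q) ->
  colour_act (twist (size f).+1) (a :: f ++ u :: q, z)
  = (rcons f a ++ u :: q, z + (\sum_(b <- f) w a b + monodromy a u)).
Proof.
move=> vx; have sz : ((size f).+1 < n)%N.
  by case: vx => /= + _; rewrite size_cat /=; lia.
have -> : twist (size f).+1
        = (\prod_(k <- rcons (iota 1 (size f).+1) (size f).+1) sigma n k)%g.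
  by rewrite big_rcons.
have r_lt : all (fun k => 0 < k < n)%N (rcons (iota 1 (size f).+1) (size f).+1).
  rewrite all_rcons sz; apply/allP=> k; rewrite mem_iota => /andP[-> le_kf].
  exact: leq_ltn_trans sz.
have [-> _] := act_sigma_prod n_gt1 r_lt (@same_balanced (a :: f ++ u :: q, z) vx).
rewrite -[LHS]/(colour_crosses (a :: f ++ u :: q, z) (rcons _ _)).
rewrite /colour_crosses foldl_rcons -/colour_crosses.
have := slide_right [::] a (rcons f u) q z.
rewrite size_rcons !cat0s !cat_rcons => ->.
rewrite /colour_cross /= swap_cat swap_weight_cat.
by rewrite big_rcons /= /monodromy !addrA.
Qed.

Lemma act_twist_expg f u q z m : (0 < size f)%N ->
  balanced_state (f ++ u :: q) ->
  (colour_act (twist (size f) ^+ m)%g (f ++ u :: q, z)).1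
  = iter m (rot 1) f ++ u :: q.
Proof.
move=> f_gt0 vf; elim: m => [|m IHm]; first by rewrite expg0 colour_act1.
rewrite expgSr colour_actM //.
have := act_balanced (twist (size f) ^+ m)%g (x := (f ++ u :: q, z)) vf.
case: (colour_act _ _) IHm => s z' /= ->.
have : size (iter m (rot 1) f) = size f.
  by elim: (m) => //= l IHl; rewrite size_rot.
case: (iter m _ f) => [|a f'] sz_f; first by rewrite -sz_f in f_gt0.
by rewrite -sz_f => vf'; rewrite act_twist // rot1_cons.
Qed.

Definition twist_shift o k u : V := w o o *+ k.-1 + monodromy o u.

Lemma act_twist_nseq o k u q z m : (0 < k)%N ->
  balanced_state (nseq k o ++ u :: q) ->
  colour_act (twist k ^+ m)%g (nseq k o ++ u :: q, z)
  = (nseq k o ++ u :: q, z + twist_shift o k u *+ m).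
Proof.
case: k => // k _ vk; elim: m => [|m IHm]; first by rewrite expg0 colour_act1 // addr0.
rewrite expgSr colour_actM // IHm.
have := @act_twist o (nseq k o) u q (z + twist_shift o k.+1 u *+ m) vk.
rewrite size_nseq => ->; congr (_, _).
  by rewrite -cats1 -[[:: o]]/(nseq 1 o) -nseqD addn1.
by rewrite big_nseq iter_addr_0 [in RHS]mulrSr -addrA.
Qed.

(** Let y be the image of the coloured state x0 = (nseq k o ++ p, 0) under the
    inverse of g.  The r-th power of the twist translates the label of x0, hence
    the m-th power translates that of y by the same amount.  So it fixes the
    colouring of y, whose first k strands must then all have colour o, because
    every colour of p occurs only once; the translation is then also computed
    from the strand at position k + 1 of y. *)
Lemma twist_conj o p k m r g : (0 < k)%N -> (k + size p)%N = n ->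
    uniq p -> o \notin p -> p != [::] -> balanced (nseq k o ++ p) ->
    ~~ (k %| m)%N -> (twist k ^+ r = (twist k ^+ m) ^ g)%g ->
  exists u q, perm_eq (u :: q) p /\
    twist_shift o k (head o p) *+ r = twist_shift o k u *+ m.
Proof.
move=> k_gt0 sz_p uniq_p o_p.
case: p => // u0 q0 in sz_p uniq_p o_p * => _ bal ndvd conj_mr.
set s0 := nseq k o ++ u0 :: q0.
have vs0 : balanced_state s0 by split=> //; rewrite size_cat size_nseq.
set e := twist_shift o k u0 *+ r.
have fix0 : colour_act (twist k ^+ r)%g (s0, 0) = (s0, e).
  by rewrite act_twist_nseq // add0r.
have vs1 := act_balanced g^-1%g (x := (s0, 0)) vs0.
have eq_s1 := act_perm g^-1%g (s0, 0).
have act_m : colour_act (twist k ^+ m)%g (colour_act g^-1%g (s0, 0))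
           = ((colour_act g^-1%g (s0, 0)).1, (colour_act g^-1%g (s0, 0)).2 + e).
  rewrite -act_translate add0r -fix0 conj_mr conjgE colour_actM //.
  rewrite colour_actM // -(colour_actM g g^-1); last by do 2!apply: act_balanced.
  by rewrite mulgV colour_act1 //; do 2!apply: act_balanced.
case: (colour_act _ _) => s1 z1 /= in vs1 eq_s1 act_m.
have sz_s1 : size s1 = (k + (size q0).+1)%N by rewrite (perm_size eq_s1) size_cat size_nseq.
rewrite -(cat_take_drop k s1) in vs1 eq_s1 act_m.
have sz_f : size (take k s1) = k by rewrite size_takel // sz_s1 leq_addr.
have sz_d : size (drop k s1) = (size q0).+1 by rewrite size_drop sz_s1 addKn.
move: (take k s1) (drop k s1) sz_f sz_d => f [|u q] // sz_f _ in vs1 eq_s1 act_m *.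
have fix_f : iter m (rot 1) f = f.
  have := congr1 fst act_m; rewrite -{1}sz_f act_twist_expg ?sz_f //= => /eqP.
  rewrite eqseq_cat; first by case/andP=> /eqP.
  by elim: (m) => //= l <-; rewrite size_rot.
have f_o : f = nseq k o.
  rewrite -sz_f; apply/all_pred1P/allP=> a a_f /=; apply/eqP; apply: contraTeq a_f => ne_ao.
  apply/negP=> a_f; have := iter_rot1_fixed fix_f _ a_f; rewrite sz_f => /(_ ndvd).
  have /permP/(_ (pred1 a)) := eq_s1; rewrite !count_cat count_nseq /=.
  rewrite [o == a]eq_sym (negbTE ne_ao) mul0n add0n.
  have := count_uniq_mem a uniq_p; have := leq_b1 (a \in u0 :: q0).
  by move=> /=; lia.
exists u, q; rewrite f_o perm_cat2l in eq_s1; split=> //.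
have := congr1 snd act_m; rewrite f_o act_twist_nseq //=; first by move/addrI.
by rewrite -f_o.
Qed.

End TwistAction.
End ColouredStrands.

(** * Conjugate powers of the twists *)

Section TwistConjugacy.

Import GRing.Theory.
Local Open Scope ring_scope.

Lemma eq_Zp_nat N a b : (1 < N)%N ->
  (a%:R == b%:R :> 'Z_N) = (a == b %[mod N])%N.
Proof. by move=> N_gt1; rewrite -val_eqE /= !val_Zp_nat. Qed.

(** One marked strand, weight 1 for two unmarked strands.  Balance at an unmarked
    strand forces the monodromy with the marked one to be - 2 * (k - 1), and
    balance at the marked strand then forces the modulus 2 * k * (k - 1).  One
    twist contributes (k - 1) - 2 * (k - 1). *)
Lemma twist1_conj n k m r (g : sphere_braid n) : (1 < k)%N -> k.+1 = n ->
    ~~ (k %| m)%N -> (twist n k ^+ r = (twist n k ^+ m) ^ g)%g ->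
  (m = r %[mod 2 * k])%N.
Proof.
move=> k_gt1 kn ndvd conj_mr.
pose N := (k.-1 * (2 * k))%N; have N_gt1 : (1 < N)%N by rewrite /N; nia.
pose w (a b : bool) : 'Z_N := if a then 0 else if b then - (2 * k.-1)%:R else 1.
have bal : balanced w (nseq k false ++ [:: true]).
  move=> a _; rewrite big_cat big_nseq big_seq1 /= iter_addr_0.
  case: a; rewrite /monodromy /w /= ?addr0 ?add0r.
    apply/eqP; rewrite mulNrn oppr_eq0 -mulrnA -[0]/(0%:R) eq_Zp_nat //.
    have -> : (2 * k.-1 * k)%N = N by rewrite /N mulnCA mulnA.
    by rewrite modnn mod0n.
  by rewrite -mulr2n -mulrnA -{1}(prednK (ltnW k_gt1)) mulnS mulrnDr addrK.
have n_gt1 : (1 < n)%N by lia.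
have sz : (k + size [:: true])%N = n by rewrite addn1.
have [u [q [eq_q]]] :=
  twist_conj (o := false) n_gt1 (ltnW k_gt1) sz isT isT isT bal ndvd conj_mr.
have -> : u = true by have := perm_mem eq_q u; rewrite !inE eqxx => /esym/eqP.
rewrite /twist_shift /monodromy /w /= addr0 mul2n -addnn mulrnDr opprD addNKr.
rewrite !mulNrn => /oppr_inj; rewrite -!mulrnA => /eqP; rewrite eq_Zp_nat //.
rewrite -!muln_modr eqn_pmul2l; last by lia.
by move/eqP.
Qed.

(** Unmarked strands count their turns around the first marked strand, and
    negatively around the second.  Balance at the marked strands needs their
    mutual monodromy to be both k and - k, whence the modulus 2 * k. *)
Lemma twist2_conj n k m r (g : sphere_braid n) : (0 < k)%N -> k.+2 = n ->
    ~~ (k %| m)%N -> (twist n k ^+ r = (twist n k ^+ m) ^ g)%g ->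
  (m = r %[mod 2 * k])%N \/ (m + r = 0 %[mod 2 * k])%N.
Proof.
move=> k_gt0 kn ndvd conj_mr.
have N_gt1 : (1 < 2 * k)%N by lia.
pose w (a b : nat) : 'Z_(2 * k) :=
  match a, b with 0, 1 => 1 | 0, 2 => -1 | 1, 2 => k%:R | _, _ => 0 end.
have bal : balanced w (nseq k 0 ++ [:: 1; 2])%N.
  have kk : k%:R + k%:R = 0 :> 'Z_(2 * k).
    apply/eqP; rewrite -natrD addnn -mul2n -[0]/(0%:R) eq_Zp_nat //.
    by rewrite modnn mod0n.
  move=> a; rewrite big_cat big_nseq 2!big_cons big_nil /= iter_addr_0.
  rewrite mem_cat mem_nseq !inE => /orP[/andP[_ /eqP->]|/orP[]/eqP->];
    rewrite /monodromy /w /= ?addr0 ?add0r ?mul0rn ?add0r ?subrr //.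
  by rewrite mulNrn addNr.
have n_gt1 : (1 < n)%N by lia.
have sz : (k + size [:: 1; 2])%N = n by rewrite addn2.
have [u [q [eq_q]]] :=
  twist_conj (o := 0%N) n_gt1 k_gt0 sz isT isT isT bal ndvd conj_mr.
have : u \in [:: 1; 2]%N by rewrite -(perm_mem eq_q) mem_head.
rewrite !inE /twist_shift /monodromy /w /= mul0rn !add0r.
case/orP=> /eqP-> /eqP; rewrite !addr0.
  by rewrite eq_Zp_nat // => /eqP; left.
rewrite mulNrn -addr_eq0 -natrD -[0]/(0%:R) eq_Zp_nat // addnC => /eqP.
by right.
Qed.

End TwistConjugacy.

(** * The Burau representation at a root of unity *)

Section BurauAtRootOfUnity.

Import GRing.Theory.
Local Open Scope ring_scope.

Variables (F : fieldType) (n : nat) (w c : F).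
Hypotheses (n_ge3 : (2 < n)%N) (w_root : w ^+ (2 * n) = 1) (w2_neq1 : w ^+ 2 != 1)
  (c_root : c ^+ n.-1 = w).

Implicit Types (x y : 'rV[F]_n) (k j : nat).

Let n_gt0 : (0 < n)%N. Proof. by rewrite ltnW // ltnW. Qed.
Let n_gt1 : (1 < n)%N. Proof. exact: ltnW. Qed.

Let w_unit : w != 0.
Proof.
by apply: contra_eq_neq w_root => ->; rewrite expr0n muln_eq0 /= gtn_eqF // eq_sym oner_neq0.
Qed.

Let c_unit : c != 0.
Proof.
apply: contra_neq w_unit => c0; rewrite -c_root c0 expr0n.
by case: n n_ge3 => [|[|]].
Qed.

Let t := w ^- 2.

Let t_unit : t != 0. Proof. by rewrite invr_eq0 expf_neq0. Qed.

Definition unit_row k : 'rV[F]_n := \row_j (val j == k)%:R.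
(** Entries indexed by nat, with value 0 out of range, so that the neighbouring
    positions k - 1 and k need no bound proofs. *)
Definition entry x k : F := (x *m (unit_row k)^T) 0 0.

Definition root_row k : 'rV[F]_n := t *: unit_row k - unit_row k.-1.
Definition gap x k : F := entry x k.-1 - entry x k.

(** The product of the rotations by t about the points x_0, ..., x_(n-1) is, up to
    a nonzero factor, the translation by x *m closing_col. *)
Definition closing_col : 'cV[F]_n := \col_j w ^+ (2 * j).
Definition ones : 'rV[F]_n := const_mx 1.

Lemma entryE x (i : 'I_n) : entry x i = x 0 i.
Proof.
rewrite /entry mxE (bigD1 i) //= big1 => [|j ne_ji].
  by rewrite !mxE eqxx mulr1 addr0.
by rewrite !mxE (negbTE (ne_ji : val j != val i)) mulr0.
Qed.

Lemma entryD x y k : entry (x + y) k = entry x k + entry y k.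
Proof. by rewrite /entry mulmxDl mxE. Qed.

Lemma entryZ a x k : entry (a *: x) k = a * entry x k.
Proof. by rewrite /entry -scalemxAl mxE. Qed.

Lemma entryN x k : entry (- x) k = - entry x k.
Proof. by rewrite /entry mulNmx mxE. Qed.

Lemma entry_ones k : (k < n)%N -> entry ones k = 1.
Proof. by move=> k_lt; rewrite (entryE _ (Ordinal k_lt)) mxE. Qed.

Lemma entry_unit j k : (k < n)%N -> entry (unit_row j) k = (k == j)%:R.
Proof. by move=> k_lt; rewrite (entryE _ (Ordinal k_lt)) mxE. Qed.

Lemma row_entryP x y : (forall k, (k < n)%N -> entry x k = entry y k) -> x = y.
Proof. by move=> xy; apply/rowP=> i; rewrite -!entryE xy. Qed.

(** The point at k - 1 passes to k and is turned by t about the point at k; see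
    entry_burau.  Written as a rank one perturbation of the identity, whose
    relations reduce to the scalars gap (root_row i) k. *)
Definition burau k : 'M[F]_n :=
  1%:M + (unit_row k.-1 - unit_row k)^T *m root_row k.
Definition burauV k : 'M[F]_n :=
  1%:M + t^-1 *: ((unit_row k.-1 - unit_row k)^T *m root_row k).

Let mul_gap x k :
  x *m ((unit_row k.-1 - unit_row k)^T *m root_row k) = gap x k *: root_row k.
Proof.
rewrite mulmxA [x *m _]mx11_scalar mul_scalar_mx; congr (_ *: _).
by rewrite linearB /= mulmxBr !mxE /gap /entry !mxE.
Qed.

Lemma mul_burau x k : x *m burau k = x + gap x k *: root_row k.
Proof. by rewrite mulmxDr mulmx1 mul_gap. Qed.

Lemma mul_burauV x k : x *m burauV k = x + (t^-1 * gap x k) *: root_row k.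
Proof. by rewrite mulmxDr mulmx1 -scalemxAr mul_gap scalerA. Qed.

Lemma gapD x y k : gap (x + y) k = gap x k + gap y k.
Proof. by rewrite /gap !entryD opprD addrACA. Qed.

Lemma gapZ a x k : gap (a *: x) k = a * gap x k.
Proof. by rewrite /gap !entryZ mulrBr. Qed.

Lemma gap_root i k : (i < n)%N -> (0 < k < n)%N ->
  gap (root_row i) k = t * ((k.-1 == i)%:R - (k == i)%:R)
                       - ((k.-1 == i.-1)%:R - (k == i.-1)%:R).
Proof.
move=> i_lt k_lt; rewrite /gap /root_row !entryD !entryN !entryZ.
by rewrite !entry_unit; [ring | lia..].
Qed.

Lemma gap_root_same k : (0 < k < n)%N -> gap (root_row k) k = - (1 + t).
Proof.
move=> k_lt; have k_n := proj2 (andP k_lt); rewrite gap_root // !eqxx.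
have [-> ->] : (k.-1 == k) = false /\ (k == k.-1) = false by lia.
by rewrite /=; ring.
Qed.

Lemma gap_root_next k : (0 < k)%N -> (k.+1 < n)%N -> gap (root_row k) k.+1 = t.
Proof.
move=> k_gt0 k_lt; rewrite gap_root ?(ltnW k_lt) //= eqxx.
have [-> -> ->] : [/\ (k.+1 == k) = false, (k == k.-1) = false
                     & (k.+1 == k.-1) = false] by split; lia.
by rewrite /=; ring.
Qed.

Lemma gap_root_prev k : (0 < k)%N -> (k.+1 < n)%N -> gap (root_row k.+1) k = 1.
Proof.
move=> k_gt0 k_lt; rewrite gap_root ?k_gt0 ?(ltnW k_lt) //= eqxx.
have [-> -> ->] : [/\ (k == k.+1) = false, (k.-1 == k) = false
                     & (k.-1 == k.+1) = false] by split; lia.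
by rewrite /=; ring.
Qed.

Lemma gap_root_far i k : (0 < i < n)%N -> (0 < k < n)%N ->
  (i.+1 < k)%N || (k.+1 < i)%N -> gap (root_row i) k = 0.
Proof.
move=> i_lt k_lt far; have i_n := proj2 (andP i_lt); rewrite gap_root //.
have [-> ->] : (k == i) = false /\ (k.-1 == i) = false by lia.
have [-> ->] : (k == i.-1) = false /\ (k.-1 == i.-1) = false by lia.
by rewrite /=; ring.
Qed.

Lemma entry_burau x k j : (0 < k < n)%N -> (j < n)%N ->
  entry (x *m burau k) j = if j == k.-1 then entry x k
    else if j == k then t * entry x k.-1 + (1 - t) * entry x k else entry x j.
Proof.
move=> k_lt j_lt; rewrite mul_burau entryD entryZ /root_row entryD entryN entryZ.
rewrite !entry_unit // /gap; have [->|ne1] := eqVneq j k.-1.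
  have -> : (k.-1 == k) = false by lia.
  by rewrite /=; ring.
by have [->|ne2] := eqVneq j k; rewrite /=; ring.
Qed.

Definition closed_row x : Prop := x *m closing_col = 0.

Definition same_row x y : Prop :=
  closed_row x /\ exists s, x = y + s *: ones.

Lemma unit_row_closing j : (j < n)%N -> unit_row j *m closing_col = (w ^+ (2 * j))%:M.
Proof.
move=> j_lt; rewrite [LHS]mx11_scalar; congr _%:M; rewrite mxE.
rewrite (bigD1 (Ordinal j_lt)) //= big1 => [|i ne_i].
  by rewrite !mxE eqxx mul1r addr0.
by rewrite !mxE (negbTE (ne_i : val i != j)) mul0r.
Qed.

Lemma root_row_closing k : (0 < k < n)%N -> root_row k *m closing_col = 0.
Proof.
move=> k_lt; rewrite mulmxBl -scalemxAl !unit_row_closing; [|lia..].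
rewrite scale_scalar_mx; apply/eqP; rewrite subr_eq0; apply/eqP; congr _%:M.
by case: k k_lt => // k _; rewrite /t mulnS exprD mulKf ?expf_neq0.
Qed.

Lemma ones_closing : ones *m closing_col = 0.
Proof.
rewrite [LHS]mx11_scalar mxE (eq_bigr (fun j : 'I_n => (w ^+ 2) ^+ j)).
  have /eqP := subrX1 (w ^+ 2) n.
  rewrite -exprM w_root subrr eq_sym mulf_eq0 subr_eq0 (negbTE w2_neq1) /=.
  by move/eqP->; rewrite raddf0.
by move=> j _; rewrite !mxE mul1r exprM.
Qed.

Lemma gap_ones k : (0 < k < n)%N -> gap ones k = 0.
Proof. by move=> k_lt; rewrite /gap !entry_ones ?subrr //; lia. Qed.

Lemma closed_burau k x : (0 < k < n)%N -> closed_row x -> closed_row (x *m burau k).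
Proof.
rewrite /closed_row => k_lt x0.
by rewrite mul_burau mulmxDl x0 -scalemxAl root_row_closing // scaler0 addr0.
Qed.

Lemma closed_burauV k x : (0 < k < n)%N -> closed_row x -> closed_row (x *m burauV k).
Proof.
rewrite /closed_row => k_lt x0.
by rewrite mul_burauV mulmxDl x0 -scalemxAl root_row_closing // scaler0 addr0.
Qed.

Lemma closedZ a x : closed_row x -> closed_row (a *: x).
Proof. by rewrite /closed_row -scalemxAl => ->; rewrite scaler0. Qed.

Lemma same_row_eq x y : closed_row x -> x = y -> same_row x y.
Proof. by move=> x0 <-; split=> //; exists 0; rewrite scale0r addr0. Qed.

Lemma same_row_closed x y : same_row x y -> closed_row y.
Proof.
case=> x0 [s xE]; move: x0; rewrite xE /closed_row mulmxDl -scalemxAl ones_closing.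
by rewrite scaler0 addr0.
Qed.

Lemma same_rowZ a x y : same_row x y -> same_row (a *: x) (a *: y).
Proof.
case=> x0 [s xE]; split; first exact: closedZ.
by exists (a * s); rewrite xE scalerDr scalerA.
Qed.

(** The factor c cancels the scalar t by which the sphere word acts: that word has
    2 * (n - 1) letters and c ^+ (2 * (n - 1)) = w ^+ 2 = t^-1. *)
Definition row_cross k x : 'rV[F]_n := x *m (c *: burau k).
Definition row_uncross k x : 'rV[F]_n := x *m (c^-1 *: burauV k).

Let row_crossE k x : row_cross k x = c *: (x *m burau k).
Proof. by rewrite /row_cross -scalemxAr. Qed.

Let row_uncrossE k x : row_uncross k x = c^-1 *: (x *m burauV k).
Proof. by rewrite /row_uncross -scalemxAr. Qed.

Lemma ones_burau k : (0 < k < n)%N -> ones *m burau k = ones.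
Proof. by move=> k_lt; rewrite mul_burau gap_ones // scale0r addr0. Qed.

Lemma ones_burauV k : (0 < k < n)%N -> ones *m burauV k = ones.
Proof. by move=> k_lt; rewrite mul_burauV gap_ones // mulr0 scale0r addr0. Qed.

Lemma burauK k x : (0 < k < n)%N -> x *m burau k *m burauV k = x.
Proof.
move=> k_lt; rewrite mul_burau mul_burauV gapD gapZ gap_root_same //.
rewrite -addrA -scalerDl -[RHS]addr0 -(scale0r (root_row k)).
by congr (_ + _ *: _); field.
Qed.

Lemma burauVK k x : (0 < k < n)%N -> x *m burauV k *m burau k = x.
Proof.
move=> k_lt; rewrite mul_burauV mul_burau gapD gapZ gap_root_same //.
rewrite -addrA -scalerDl -[RHS]addr0 -(scale0r (root_row k)).
by congr (_ + _ *: _); field.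
Qed.

Lemma burau_far i j x : (0 < i)%N -> (i.+1 < j)%N -> (j < n)%N ->
  x *m burau i *m burau j = x *m burau j *m burau i.
Proof.
move=> i_gt0 lt_ij lt_jn; have [i_n j_n] : (0 < i < n /\ 0 < j < n)%N by lia.
rewrite !(mul_burau x) !mul_burau !gapD !gapZ !gap_root_far ?lt_ij ?orbT //.
by rewrite !mulr0 !addr0 addrAC.
Qed.

Lemma burau_braid i x : (0 < i)%N -> (i.+1 < n)%N ->
  x *m burau i *m burau i.+1 *m burau i
  = x *m burau i.+1 *m burau i *m burau i.+1.
Proof.
move=> i_gt0 lt_in; have i_n : (0 < i < n)%N by rewrite i_gt0 ltnW.
rewrite !mul_burau !gapD !gapZ !gap_root_same // gap_root_next // gap_root_prev //.
rewrite -!addrA; congr (_ + _).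
rewrite addrCA -scalerDl [in RHS]addrCA -scalerDl [RHS]addrC.
by congr (_ *: _ + _ *: _); rewrite /gap; ring.
Qed.

Definition shift_mx m : 'M[F]_n := \matrix_(i, j) (i == iter m (@ordS n) j)%:R.

Lemma mul_shift m x (j : 'I_n) : (x *m shift_mx m) 0 j = x 0 (iter m (@ordS n) j).
Proof.
rewrite mxE (bigD1 (iter m (@ordS n) j)) //= big1 => [|i ne_i].
  by rewrite mxE eqxx mulr1 addr0.
by rewrite mxE (negbTE ne_i) mulr0.
Qed.

Lemma shift_mxS m : shift_mx m.+1 = shift_mx m *m shift_mx 1.
Proof.
apply/row_matrixP=> i; apply/rowP=> j.
by rewrite row_mul mul_shift !mxE iterSr.
Qed.

Lemma entry_shift x j : (j < n)%N ->
  entry (x *m shift_mx 1) j = if j == n.-1 then entry x 0 else entry x j.+1.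
Proof.
move=> j_lt; rewrite (entryE _ (Ordinal j_lt)) mul_shift -entryE /=.
have [->|ne_j] := eqVneq; first by rewrite prednK // modnn.
by rewrite modn_small //; lia.
Qed.

Lemma shift_closing m : shift_mx m *m closing_col = t ^+ m *: closing_col.
Proof.
elim: m => [|m IHm].
  rewrite expr0 scale1r -[RHS]mul1mx; congr (_ *m _).
  by apply/matrixP=> i j; rewrite !mxE.
rewrite shift_mxS -mulmxA; suff -> : shift_mx 1 *m closing_col = t *: closing_col.
  by rewrite -scalemxAr IHm scalerA exprS.
apply/colP=> i; rewrite -(ord_predK i) mxE (bigD1 (ord_pred i)) //= big1.
  rewrite !mxE eqxx mul1r addr0 !exprM /t /=.
  set e := val (ord_pred i).
  have -> : (w ^+ 2) ^+ (e.+1 %% n) = (w ^+ 2) ^+ e.+1.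
    by rewrite expr_mod // -exprM.
  by rewrite (exprS (w ^+ 2) e) mulKf // expf_neq0.
move=> j ne_j; rewrite mxE /= (inj_eq (@ordS_inj n)) eq_sym (negbTE ne_j).
by rewrite mul0r.
Qed.

Lemma closed_shift m x : closed_row x -> closed_row (x *m shift_mx m).
Proof.
by rewrite /closed_row -mulmxA shift_closing -scalemxAr => ->; rewrite scaler0.
Qed.

Definition burau_moves x r : 'rV[F]_n := foldl (fun y k => y *m burau k) x r.

Lemma burau_movesZ a x r : burau_moves (a *: x) r = a *: burau_moves x r.
Proof. by elim: r x => //= k r IHr x; rewrite -scalemxAl IHr. Qed.

Lemma row_crosses x r :
  foldl (fun y k => row_cross k y) x r = c ^+ size r *: burau_moves x r.
Proof.
elim: r x => [|k r IHr] x /=; first by rewrite expr0 scale1r.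
by rewrite IHr row_crossE burau_movesZ scalerA exprSr.
Qed.

Lemma closed_burau_moves x r : all (fun k => 0 < k < n)%N r ->
  closed_row x -> closed_row (burau_moves x r).
Proof.
elim: r x => //= k r IHr x /andP[k_lt r_lt] x0.
by apply: IHr => //; apply: closed_burau.
Qed.

(** The point that starts at 0 runs to position m and the others step back by one.
    The value at m itself is left out: on closed rows it follows from the
    closing equation. *)
Lemma burau_moves_up x m j : (m < n)%N -> (j < n)%N -> j != m ->
  entry (burau_moves x (iota 1 m)) j = if (j < m)%N then entry x j.+1 else entry x j.
Proof.
move=> + j_lt; elim: m j j_lt => [|m IHm] j j_lt m_lt ne_jm; first by rewrite ltn0.
have -> : iota 1 m.+1 = rcons (iota 1 m) m.+1.
  by rewrite -cats1 -(iotaD 1 m 1) addn1.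
rewrite /burau_moves foldl_rcons -/(burau_moves _ _) entry_burau //=.
have [->|ne_j] := eqVneq j m.
  by rewrite ltnSn IHm // ?ltnNge ?leqnSn //=; lia.
rewrite (negbTE ne_jm) IHm //; last exact: ltnW.
by have -> : (j < m.+1)%N = (j < m)%N by lia.
Qed.

(** The moving point is turned about all the others, whose rotations compose to
    the inverse of its own, so it returns unchanged. *)
Lemma burau_moves_shift x : closed_row x ->
  burau_moves x (index_iota 1 n) = x *m shift_mx 1.
Proof.
move=> x0; rewrite /index_iota subn1; set y := burau_moves _ _.
have y0 : closed_row y.
  by apply: closed_burau_moves => //; apply/allP=> k; rewrite mem_iota; lia.
have last_lt : (n.-1 < n)%N by rewrite prednK.
(* All entries but the last agree by burau_moves_up, and closing_col has no zero
   entry, so the closing equation settles the last one. *)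
suff : (y - x *m shift_mx 1) 0 (Ordinal last_lt) = 0.
  rewrite -entryE /= entryD entryN => /eqP; rewrite subr_eq0 => /eqP last_eq.
  apply: row_entryP => k k_lt; have [->|ne_k] := eqVneq k n.-1; first by [].
  by rewrite burau_moves_up // entry_shift // (negbTE ne_k); case: ltnP => //; lia.
have : (y - x *m shift_mx 1) *m closing_col = 0.
  by rewrite mulmxBl y0 (closed_shift 1 x0) subrr.
move/matrixP/(_ 0 0); rewrite mxE (bigD1 (Ordinal last_lt)) //= big1.
  by rewrite !mxE addr0 => /eqP; rewrite mulf_eq0 expf_eq0 (negbTE w_unit) andbF orbF => /eqP.
move=> j ne_j; have lt_j : (j < n.-1)%N.
  by have := ltn_ord j; have : nat_of_ord j != n.-1 := ne_j; lia.
rewrite -entryE entryD entryN burau_moves_up // ?ltn_eqF // lt_j entry_shift //.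
by rewrite ltn_eqF // subrr mul0r.
Qed.

(** On its way back the point x_0 turns every point that it passes. *)
Lemma burau_moves_down x m j : (m < n)%N -> (j < n)%N ->
  entry (burau_moves (x *m shift_mx 1) (rev (iota (n - m) m))) j
  = if (j < n.-1 - m)%N then entry x j.+1
    else if j == (n.-1 - m)%N then entry x 0
    else t * entry x j + (1 - t) * entry x 0.
Proof.
elim: m j => [|m IHm] j m_lt j_lt.
  rewrite !subn0 /burau_moves /= entry_shift //.
  by have [->|ne_j] := eqVneq j n.-1; [rewrite ltnn | case: ltnP => //; lia].
rewrite /= rev_cons /burau_moves foldl_rcons -/(burau_moves _ _).
rewrite (_ : (n - m.+1).+1 = (n - m)%N); last by lia.
rewrite entry_burau //; last by lia.
rewrite !IHm; [|lia..].
have [e1 e2 e3] : [/\ (n - m.+1).-1 = (n.-1 - m.+1)%N, (n - m.+1)%N = (n.-1 - m)%N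
  & (n.-1 - m)%N = (n.-1 - m.+1).+1] by split; lia.
rewrite e1 e2 ltnn eqxx e3 ltnSn.
case: ltngtP => [lt_j|gt_j|eq_j]; case: (ltngtP j (n.-1 - m.+1)) => //; try by lia.
by rewrite eq_j.
Qed.

(** The way out is the shift; the way back turns the whole configuration about
    x_0, which modulo constant rows is multiplication by t. *)
Lemma row_sphere x : closed_row x ->
  same_row (foldl (fun y k => row_cross k y) x
              (index_iota 1 n ++ rev (index_iota 1 n))) x.
Proof.
move=> x0; rewrite row_crosses /burau_moves foldl_cat -!/(burau_moves _ _).
rewrite burau_moves_shift //; set y := burau_moves _ _.
have yE : y = t *: x + ((1 - t) * entry x 0) *: ones.
  apply: row_entryP => j j_lt; rewrite entryD !entryZ entry_ones // mulr1.
  have e1 : (1 = n - n.-1)%N by lia.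
  rewrite /y /index_iota subn1 [X in iota X]e1 burau_moves_down ?prednK // subnn.
  by have [->|//] := eqVneq j 0; ring.
have -> : c ^+ size (index_iota 1 n ++ rev (index_iota 1 n)) = t^-1.
  by rewrite size_cat size_rev size_iota subn1 exprD c_root -expr2 /t invrK.
have y_closed : closed_row y.
  rewrite /closed_row yE mulmxDl -!scalemxAl x0 ones_closing.
  by rewrite !scaler0 addr0.
split; first exact: closedZ.
exists (t^-1 * ((1 - t) * entry x 0)).
by rewrite yE scalerDr !scalerA mulVf // scale1r.
Qed.

Definition burau_action : sphere_action n 'rV[F]_n.
Proof.
refine (@SphereAction n 'rV[F]_n row_cross row_uncross same_row
  _ _ _ _ _ _ _ _ _).
- move=> x y xy; split; first exact: same_row_closed xy.
  by case: xy => _ [s ->]; exists (- s); rewrite scaleNr addrK.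
- move=> x y z [x0 [s xE]] [y0 [u yE]]; split=> //.
  by exists (u + s); rewrite xE yE scalerDl addrA.
- move=> k x y k_lt [x0 [s xE]]; rewrite !row_crossE; apply: same_rowZ.
  split; first exact: closed_burau.
  by exists s; rewrite xE mulmxDl -scalemxAl ones_burau.
- move=> k x y k_lt [x0 [s xE]]; rewrite !row_uncrossE; apply: same_rowZ.
  split; first exact: closed_burauV.
  by exists s; rewrite xE mulmxDl -scalemxAl ones_burauV.
- move=> k x k_lt [x0 _]; rewrite row_uncrossE row_crossE -scalemxAl burauK //.
  by rewrite scalerA mulVf // scale1r; apply: same_row_eq.
- move=> k x k_lt [x0 _]; rewrite row_crossE row_uncrossE -scalemxAl burauVK //.
  by rewrite scalerA mulfV // scale1r; apply: same_row_eq.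
- move=> i j x i_gt0 lt_ij lt_jn [x0 _].
  rewrite !row_crossE -!scalemxAl -burau_far //.
  by apply: same_row_eq => //; do 2!apply/closedZ; do 2!(apply: closed_burau; first by lia).
- move=> i x i_gt0 lt_in [x0 _].
  rewrite !row_crossE -!scalemxAl burau_braid //.
  by apply: same_row_eq => //; do 3!apply/closedZ; do 3!(apply: closed_burau; first by lia).
- by move=> x [x0 _]; apply: row_sphere.
Defined.

(** A projector onto closed rows that kills the constant rows: unit_row 0 is dual
    to closing_col and (unit_row 1)^T is dual to ones. *)
Definition quot_proj : 'M[F]_n :=
  1%:M - closing_col *m unit_row 0 - (unit_row 1)^T *m ones.

Let unit0_closing : unit_row 0 *m closing_col = 1%:M.
Proof. by rewrite unit_row_closing // expr0. Qed.

Let ones_unit1 : ones *m (unit_row 1)^T = 1%:M.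
Proof. by rewrite [LHS]mx11_scalar -/(entry _ _) entry_ones. Qed.

Let unit0_unit1 : unit_row 0 *m (unit_row 1)^T = 0.
Proof. by rewrite [LHS]mx11_scalar -/(entry _ _) entry_unit //= raddf0. Qed.

Lemma quot_proj_closing : quot_proj *m closing_col = 0.
Proof.
rewrite !mulmxBl mul1mx -!mulmxA unit0_closing mulmx1 subrr ones_closing mulmx0.
by rewrite subrr.
Qed.

Lemma closed_quot_proj x : closed_row (x *m quot_proj).
Proof. by rewrite /closed_row -mulmxA quot_proj_closing mulmx0. Qed.

Lemma ones_quot_proj : ones *m quot_proj = 0.
Proof.
rewrite !mulmxBr mulmx1 mulmxA ones_closing mul0mx subr0.
by rewrite mulmxA ones_unit1 mul1mx subrr.
Qed.

Lemma same_quot_proj x : closed_row x -> same_row (x *m quot_proj) x.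
Proof.
move=> x0; split; first exact: closed_quot_proj.
exists (- entry x 1); rewrite !mulmxBr mulmx1 mulmxA x0 mul0mx subr0.
by rewrite mulmxA [x *m _]mx11_scalar mul_scalar_mx scaleNr.
Qed.

Lemma same_row_quot_proj x y : same_row x y -> x *m quot_proj = y *m quot_proj.
Proof.
by case=> _ [s ->]; rewrite mulmxDl -scalemxAl ones_quot_proj scaler0 addr0.
Qed.

Lemma quot_proj_idem : quot_proj *m quot_proj = quot_proj.
Proof.
have proj_unit1 : quot_proj *m (unit_row 1)^T = 0.
  rewrite !mulmxBl mul1mx -!mulmxA unit0_unit1 mulmx0 subr0.
  by rewrite ones_unit1 mulmx1 subrr.
rewrite {2}/quot_proj !mulmxBr mulmx1 !mulmxA quot_proj_closing proj_unit1 !mul0mx.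
by rewrite !subr0.
Qed.

Definition word_mx (v : word (braid_gen n)) : 'M[F]_n :=
  foldr (fun l M => (if l.2 then c *: burau (val l.1)
                     else c^-1 *: burauV (val l.1)) *m M) 1%:M v.

Lemma mul_word_mx v x : x *m word_mx v = run burau_action v x.
Proof.
elim: v x => [|[k b] v IHv] x /=; first by rewrite mulmx1.
by rewrite mulmxA IHv; case: b.
Qed.

(** The action on closed rows modulo constant rows, as a corner of the full matrix
    algebra; its unit is quot_proj. *)
Definition quot_rep (g : sphere_braid n) : 'M[F]_n :=
  quot_proj *m word_mx (prepr g) *m quot_proj.

Local Notation row_act := (act burau_action).

Lemma mul_quot_rep x g : x *m quot_rep g = row_act g (x *m quot_proj) *m quot_proj.
Proof. by rewrite !mulmxA mul_word_mx. Qed.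

Let same_refl x : closed_row x -> same burau_action x x.
Proof. by move=> x0; apply: same_row_eq. Qed.

Lemma act_closed g x : closed_row x -> closed_row (row_act g x).
Proof. by move/same_refl/(act_same (A := burau_action) g) => -[]. Qed.

Lemma quot_repM g h : quot_rep (g * h)%g = quot_rep g *m quot_rep h.
Proof.
apply/row_matrixP=> i; rewrite !rowE mulmxA !mul_quot_rep.
have x0 := closed_quot_proj (delta_mx 0 i); set x := _ *m quot_proj in x0 *.
have [gx0 gxP] := (act_closed g x0, same_quot_proj (act_closed g x0)).
rewrite -[row_act g x *m quot_proj *m quot_proj]mulmxA quot_proj_idem.
rewrite (same_row_quot_proj (act_same (A := burau_action) h gxP)).
exact/same_row_quot_proj/(actM n_gt1 (A := burau_action))/same_refl.
Qed.

Lemma trace_quot_repJ g h : \tr (quot_rep (g ^ h)%g) = \tr (quot_rep g).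
Proof. by rewrite conjgE quot_repM mxtrace_mulC -quot_repM mulgK. Qed.

Lemma act_alpha0 m x : closed_row x ->
  same_row (row_act (alpha0 n ^+ m)%g x) (w ^+ m *: (x *m shift_mx m)).
Proof.
move=> x0; elim: m => [|m IHm].
  suff -> : x *m shift_mx 0 = x 
    by rewrite expr0 scale1r; apply: (act1 n_gt1 (same_refl x0)).
  by apply/rowP=> j; rewrite mul_shift.
rewrite expgSr.
have := actM n_gt1 (alpha0 n ^+ m)%g (alpha0 n) (same_refl x0).
move/(@same_trans _ _ burau_action); apply.
have := act_same (A := burau_action) (alpha0 n) IHm.
move/(@same_trans _ _ burau_action); apply.
have y0 : closed_row (w ^+ m *: (x *m shift_mx m)) by apply/closedZ/closed_shift.
have r_lt : all (fun k => 0 < k < n)%N (index_iota 1 n).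
  by apply/allP=> k; rewrite mem_index_iota.
have := act_sigma_prod n_gt1 r_lt (same_refl y0).
move/(@same_trans _ _ burau_action); apply.
rewrite /crosses /= row_crosses size_iota subn1 c_root burau_moves_shift //.
rewrite -scalemxAl scalerA -mulmxA -shift_mxS -exprS.
by apply: same_row_eq => //; apply/closedZ/closed_shift.
Qed.

Lemma quot_rep_alpha0 m :
  quot_rep (alpha0 n ^+ m)%g = w ^+ m *: (quot_proj *m shift_mx m *m quot_proj).
Proof.
apply/row_matrixP=> i; rewrite !rowE mul_quot_rep -scalemxAr !mulmxA scalemxAl.
exact/same_row_quot_proj/act_alpha0/closed_quot_proj.
Qed.

Lemma iter_ordS m (i : 'I_n) : val (iter m (@ordS n) i) = ((i + m) %% n)%N.
Proof.
elim: m => [|m IHm]; first by rewrite addn0 modn_small.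
by rewrite iterS /= IHm -addn1 modnDml addn1 addnS.
Qed.

(** The shift has trace 0, from which the two directions removed by quot_proj
    subtract t ^+ m for closing_col and 1 for ones. *)
Lemma trace_quot_rep_alpha0 m : ~~ (n %| m)%N ->
  \tr (quot_rep (alpha0 n ^+ m)%g) = - (w ^+ m + w ^- m).
Proof.
move=> ndvd; rewrite quot_rep_alpha0 mxtraceZ mxtrace_mulC mulmxA quot_proj_idem.
rewrite mxtrace_mulC !mulmxBr mulmx1 !mulmxA !raddfB /= shift_closing.
have -> : \tr (shift_mx m) = 0.
  apply: big1 => i _; rewrite mxE -val_eqE /= iter_ordS eq_sym.
  suff -> : ((i + m) %% n == i)%N = false by [].
  apply: contraNF ndvd; rewrite -[X in _ == X](modn_small (ltn_ord i)).
  by rewrite -{2}[val i]addn0 eqn_modDl mod0n.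
have -> : \tr (shift_mx m *m (unit_row 1)^T *m ones) = 1.
  rewrite mxtrace_mulC mulmxA; suff -> : ones *m shift_mx m = ones.
    by rewrite ones_unit1 mxtrace1.
  by apply/rowP=> j; rewrite mul_shift !mxE.
rewrite -scalemxAl mxtraceZ mxtrace_mulC unit0_closing mxtrace1 mulr1.
have wm0 : w ^+ m != 0 by rewrite expf_neq0.
by rewrite /t exprVn exprAC -exprVn; field.
Qed.

End BurauAtRootOfUnity.

(** * Powers of the torsion elements *)

Section AlphaConjugacy.

Import GRing.Theory Num.Theory.
Local Open Scope ring_scope.

(** Equality of w ^+ m + w ^- m and w ^+ r + w ^- r factors as
    (w ^+ r - w ^+ m) * (w ^+ (m + r) - 1) = 0. *)
Lemma alpha0_conj n m r (g : sphere_braid n) : (2 < n)%N ->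
    ~~ (n %| m)%N -> ~~ (n %| r)%N -> (alpha0 n ^+ r = (alpha0 n ^+ m) ^ g)%g ->
  (m = r %[mod 2 * n])%N \/ (m + r = 0 %[mod 2 * n])%N.
Proof.
move=> n_ge3 ndvd_m ndvd_r conj_mr.
have N_gt0 : (0 < 2 * n)%N by lia.
have [w w_prim] := C_prim_root_exists N_gt0.
have w2_neq1 : w ^+ 2 != 1.
  by rewrite -(expr0 w) (eq_prim_root_expr w_prim) mod0n modn_small //; lia.
have w_root := prim_expr_order w_prim.
have w0 : w != 0 
  by apply: contra_eq_neq w_root => ->; rewrite expr0n gtn_eqF // eq_sym oner_neq0.
have n1_gt0 : (0 < n.-1)%N by lia.
have c_root : (n.-1.-root w) ^+ n.-1 = w := rootCK n1_gt0 w.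
have := trace_quot_repJ n_ge3 w_root w2_neq1 c_root (alpha0 n ^+ m)%g g.
rewrite -conj_mr !trace_quot_rep_alpha0 // => /oppr_inj tr_eq.
have /eqP : (w ^+ r - w ^+ m) * (w ^+ (m + r) - 1) = 0.
  have w_m : w ^+ m != 0 by rewrite expf_neq0.
  have w_r : w ^+ r != 0 by rewrite expf_neq0.
  have -> : (w ^+ r - w ^+ m) * (w ^+ (m + r) - 1)
          = w ^+ (m + r) * ((w ^+ r + w ^- r) - (w ^+ m + w ^- m)).
    by rewrite exprD; field; rewrite w_m.
  by rewrite tr_eq subrr mulr0.
rewrite mulf_eq0 !subr_eq0 => /orP[] /eqP.
  by move/eqP; rewrite (eq_prim_root_expr w_prim) eq_sym => /eqP; left.
by move/eqP; rewrite -(expr0 w) (eq_prim_root_expr w_prim) => /eqP; right.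
Qed.

End AlphaConjugacy.

Section IntegerPowers.

Local Open Scope group_scope.

Variables (G : groupType) (x : G) (N : nat).
Hypotheses (N_gt0 : 0 < N) (x_N : x ^+ N = 1).

Lemma expg_modn m : x ^+ (m %% N) = x ^+ m.
Proof. by rewrite [in RHS](divn_eq m N) expgnDr mulnC expgnA x_N expg1n mul1g. Qed.

Lemma expgz_natE (m : int) : exists k : nat, expgz x m = x ^+ k.
Proof.
case: m => k; first by exists k.
exists (N.-1 * k.+1)%N; apply/mulg1_eq; rewrite -expgnDr -mulSn prednK //.
by rewrite expgnA x_N expg1n.
Qed.

Lemma expgzN (m : int) : expgz x (- m)%R = (expgz x m)^-1.
Proof. by case: m => [[|k]|k] //=; rewrite ?invg1 ?invgK. Qed.

End IntegerPowers.

Section AlphaPowers.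

Local Open Scope group_scope.

Variables (n : nat) (i : 'I_3).
Hypothesis n_ge3 : 2 < n.

Let i_le2 : i <= 2. Proof. by rewrite -ltnS ltn_ord. Qed.

Let k := n - i.

Let k_gt0 : 0 < k. Proof. by rewrite subn_gt0 (leq_ltn_trans i_le2). Qed.

Lemma alpha_order : alpha n i ^+ (2 * k) = 1.
Proof. by rewrite mulnC expgnA alpha_full_twist // expg2 full_twist2. Qed.

Lemma alpha_central m g : k %| m -> commute (alpha n i ^+ m) g.
Proof.
case/dvdnP=> l ->; rewrite mulnC expgnA alpha_full_twist //.
by apply/commute_sym/commuteX/commute_sym/full_twist_central.
Qed.

Lemma conj_alpha_mod m r g : ~~ (k %| m) -> ~~ (k %| r) ->
    alpha n i ^+ r = (alpha n i ^+ m) ^ g ->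
  m = r %[mod 2 * k] \/ i <> 1%N :> nat /\ m + r = 0 %[mod 2 * k].
Proof.
rewrite /k alpha_asc //; case: i => [[|[|[|//]]] i_lt] /=.
- rewrite subn0 => ndvd_m ndvd_r.
  have -> : asc (sigma n) n.-1 = alpha0 n by rewrite /asc prednK // ltnW // ltnW.
  by case/(alpha0_conj n_ge3 ndvd_m ndvd_r); [left | right].
- move=> ndvd_m _ /twist1_conj eq_mr.
  by left; apply: eq_mr => //; lia.
- move=> ndvd_m _ /twist2_conj eq_mr.
  by case: eq_mr => //; [lia | lia | left | right].
Qed.

(** An exponent divisible by k gives a central power, which conjugation fixes. *)
Lemma conj_alpha_expg m r g : alpha n i ^+ r = (alpha n i ^+ m) ^ g ->
  alpha n i ^+ m = alpha n i ^+ r \/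
  i <> 1%N :> nat /\ alpha n i ^+ m = (alpha n i ^+ r)^-1.
Proof.
move=> conj_mr; have N_gt0 : 0 < 2 * k by rewrite muln_gt0.
have [dvd_m|ndvd_m] := boolP (k %| m).
  by left; rewrite conj_mr conjgE alpha_central // mulKg.
have [dvd_r|ndvd_r] := boolP (k %| r).
  left; apply: (conjg_inj g); rewrite -conj_mr conjgE.
  by rewrite (alpha_central g dvd_r) mulKg.
case: (conj_alpha_mod ndvd_m ndvd_r conj_mr) => [eq_mr|[i_neq1 eq_mr]].
  by left; rewrite -(expg_modn alpha_order) eq_mr expg_modn // alpha_order.
right; split=> //; apply/esym/mulg1_eq; rewrite -expgnDr addnC.
by rewrite -(expg_modn alpha_order) eq_mr mod0n.
Qed.

End AlphaPowers.

Theorem proposition9 (n : nat) (i : 'I_3) (r m : int) :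
  (3 <= n)%N ->
  conjugate (expgz (alpha n i) m) (expgz (alpha n i) r) ->
  (i = 1 :> nat -> expgz (alpha n i) m = expgz (alpha n i) r) /\
  (i = 0 :> nat \/ i = 2 :> nat ->
     expgz (alpha n i) m = expgz (alpha n i) r \/
     expgz (alpha n i) m = expgz (alpha n i) (- r)%R).
Proof.
move=> n_ge3 [g]; rewrite expgzN.
have N_gt0 : 0 < 2 * (n - i).
  by rewrite muln_gt0 subn_gt0 (leq_ltn_trans _ n_ge3) // -ltnS ltn_ord.
have [m' ->] := expgz_natE N_gt0 (alpha_order i n_ge3) m.
have [r' ->] := expgz_natE N_gt0 (alpha_order i n_ge3) r.
by case/(conj_alpha_expg n_ge3) => [|[]]; split; auto.
Qed.
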